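(* Let $G$ be a finite connected graph with chromatic number $\chi(G)=3$, and suppose $G$ is not isomorphic to the cycle $C_7$ on seven vertices. Then $G$ admits a proper $3$-coloring $c:V(G)\to\{1,2,3\}$ such that every vertex $x$ of $G$ is the first vertex of a colorful path, i.e. for every $x\in V(G)$ there is a path $x=x_1x_2x_3$ in $G$ on three distinct vertices with $c(x_1),c(x_2),c(x_3)$ pairwise distinct.
   Context: A proper $k$-coloring of a graph $G$ is a map $c:V(G)\to\{1,\dots,k\}$ with $c(u)\neq c(v)$ whenever $u,v$ are adjacent. Given a $\chi(G)$-coloring, a colorful path is a path on $\chi(G)$ distinct vertices whose vertices receive pairwise distinct colors (hence every color appears exactly once on it). *)

(* Defs.v *)
From mathcomp Require Import all_boot.
Set Implicit Arguments. Unset Strict Implicit. Unset Printing Implicit Defensive.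

Definition simple_graph (T : finType) (e : rel T) : Prop :=
  symmetric e /\ irreflexive e.

Definition proper_coloring (T : finType) (e : rel T) (k : nat) (c : T -> 'I_k) : Prop :=
  forall x y, e x y -> c x != c y.

Definition k_colorable (T : finType) (e : rel T) (k : nat) : Prop :=
  exists c : T -> 'I_k, proper_coloring e c.

Definition chromatic_number_eq (T : finType) (e : rel T) (k : nat) : Prop :=
  k_colorable e k /\ ~ k_colorable e k.-1.

Definition connected_graph (T : finType) (e : rel T) : Prop :=
  forall x y : T, connect e x y.

Definition cycle_rel (n : nat) : rel 'I_n :=
  fun i j => (j == (i.+1 %% n) :> nat) || (i == (j.+1 %% n) :> nat).

Definition graph_iso (T T' : finType) (e : rel T) (e' : rel T') : Prop :=
  exists f : T -> T', bijective f /\ forall x y, e x y = e' (f x) (f y).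

Definition colorful_path3_from (T : finType) (e : rel T) (c : T -> 'I_3) (x : T) : Prop :=
  exists y z : T, [/\ e x y, e y z, uniq [:: x; y; z] & uniq [:: c x; c y; c z]].
Arguments cycle_rel n : clear implicits.

(* Main.v *)
Require Import Defs.
From Stdlib Require Import ZArith Lia Classical.
From mathcomp Require Import all_boot.
Set Implicit Arguments. Unset Strict Implicit. Unset Printing Implicit Defensive.

(** Direct an edge from u to v when c v = c u + 1 (mod 3).  A vertex starts a
colorful path iff some neighbour has both an in-arc and an out-arc, and a source
may be recolored (its color decreased by 1) into a sink.  A coloring in which
every vertex reaches r is good unless some neighbour y of r sees only sources
besides r; then all of N(y) may be lowered and y takes the place of r.  If no
coloring is good this goes on forever, hence periodically, and yields a
bi-infinite walk r_j such that, for adjacent u and v, the sets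
A(u) = { j | u ~ r_j } and A(v) alternate with steps congruent to 1 mod 3.  The
colors at a given time can be read off from the last elements of the A(v), so
other colorings are obtained by lowering suitable sets.  Three families of these
show in turn that a vertex v with j, j+5 in A(v) has neighbours w with j+1, j+6
and with j-1, j+4 in A(w), that r_j ~ r_(j+6), and that r_j and r_(j+7) have the
same neighbourhood.  Then G is C_7 with some vertices replicated; a replicated
vertex can be given two colors, which makes a good coloring. *)

(** * Colors modulo 3 and colorful paths *)

Local Notation sc := (@ordS 3).

Lemma sc3 x : sc (sc (sc x)) = x.
Proof. by apply: val_inj; case: x => [[|[|[|]]]]. Qed.

Lemma sc_neq x : sc x != x.
Proof. by case: x => [[|[|[|]]]]. Qed.

Lemma sc2_neq x : sc (sc x) != x.
Proof. by case: x => [[|[|[|]]]]. Qed.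

Lemma scI : injective sc.
Proof. by move=> x y E; rewrite -(sc3 x) -(sc3 y) E. Qed.

Lemma sc_total x y : x != y -> y = sc x \/ x = sc y.
Proof.
case: x => [[|[|[|//]]] x3]; case: y => [[|[|[|//]]] y3] //= _;
  by [left; apply: val_inj | right; apply: val_inj].
Qed.

Definition darc (T : finType) (e : rel T) (c : T -> 'I_3) (u v : T) :=
  e u v && (c v == sc (c u)).

Definition good_coloring (T : finType) (e : rel T) (c : T -> 'I_3) : Prop :=
  proper_coloring e c /\
  forall v, exists u, [/\ e v u, exists w, darc e c w u & exists w, darc e c u w].

(** The edge from [x] to [u] is continued in its own direction, by an out-arc or an in-arc of [u]; a
    directed path on three vertices shows all colors. *)
Lemma good_coloring_colorful (T : finType) (e : rel T) c :
  symmetric e -> good_coloring e c -> forall x, colorful_path3_from e c x.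
Proof.
move=> symE [pc good] x; have [u [xu [w /andP[wu /eqP cwu]] [t /andP[ut /eqP cut]]]] := good x.
have uw : e u w by rewrite symE.
suff [z [uz xz]] : exists z, e u z /\ c x != c z.
  have cu : c x != c u by apply: pc.
  have cz : c u != c z by apply: pc.
  exists u, z; split => //=; rewrite !inE ?negb_or ?cu ?xz ?cz //=.
  by rewrite (contraNneq _ cu) 1?(contraNneq _ xz) 1?(contraNneq _ cz) // => ->.
case: (sc_total (pc _ _ xu)) => E.
- exists t; split => //; rewrite cut E eq_sym; exact: sc2_neq.
- exists w; split => //; rewrite E cwu; exact: sc2_neq.
Qed.

Definition col (z : Z) : 'I_3 := inord (Z.to_nat (z mod 3)).

Lemma col_sc a b : ((b - a) mod 3 = 1)%Z -> col b = sc (col a).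
Proof.
move=> E; apply: val_inj => /=; rewrite /col.
have lt3 z : Z.to_nat (z mod 3) < 3.
  by apply/ltP; have := Z.mod_pos_bound z 3; lia.
rewrite !inordK //.
have [|[|]] : ((a mod 3 = 0 /\ b mod 3 = 1) \/ (a mod 3 = 1 /\ b mod 3 = 2) \/
  (a mod 3 = 2 /\ b mod 3 = 0))%Z by Z.to_euclidean_division_equations; lia.
all: by case=> -> ->.
Qed.

(* Coloring the classes 1, ..., 6 by 0, 1, 2, 1, 2, 0 leaves colors 1 and 2
   available on class 0; once both are used, the classes 1, 2, 5 and 6 see two
   colors, and every class is next to one of them. *)
Lemma C7_blowup_good (T : finType) (e : rel T) (g : T -> 'I_7) (q : 'I_7 -> T) x0 x1 :
  irreflexive e -> (forall x y, e x y = cycle_rel 7 (g x) (g y)) ->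
  (forall i, g (q i) = i) -> x0 != x1 -> g x0 = ord0 -> g x1 = ord0 ->
  exists c, good_coloring e c.
Proof.
move=> irrE hom gq x01 gx0 gx1.
pose tab i := nth 0 [:: 2; 0; 1; 2; 1; 2; 0] i.
pose h v := if v == x0 then 1 else tab (g v).
have h3 v : h v < 3.
  by rewrite /h; case: eqP => // _; case: (g v); do 7 (case=> [//|]).
have hne v : v != x0 -> h v = tab (g v) by rewrite /h => /negbTE ->.
have hx1 : h x1 = 2 by rewrite hne ?gx1 // eq_sym.
have hx0 : h x0 = 1 by rewrite /h eqxx.
have hq (i : 'I_7) : 0 < i -> h (q i) = tab i.
  move=> i0; rewrite hne ?gq //; apply: contraTneq i0 => E.
  by rewrite -(gq i) E gx0.
pose c v : 'I_3 := inord (h v).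
have arcP u v : e u v -> h v = (h u).+1 %% 3 -> darc e c u v.
  move=> uv E; rewrite /darc uv; apply/eqP; apply: val_inj.
  by rewrite /= !inordK ?h3.
have s1 i (i7 : i < 7) : exists2 j : 'I_7, j = i :> nat & True by exists (Ordinal i7).
have [[q1 E1 _] [q2 E2 _] [q3 E3 _]] := And3 (s1 1 isT) (s1 2 isT) (s1 3 isT).
have [[q4 E4 _] [q5 E5 _] [q6 E6 _]] := And3 (s1 4 isT) (s1 5 isT) (s1 6 isT).
exists c; split.
  move=> x y xy; apply: contraTneq xy => cxy; have {cxy} : h x = h y.
    by have := congr1 val cxy; rewrite /= !inordK ?h3.
  rewrite hom; have [->|xx0] := eqVneq x x0.
    have [->|yx0] := eqVneq y x0; first by rewrite -hom irrE.
    by rewrite hx0 hne // gx0; case: (g y); do 7 (case=> [//|]).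
  have [->|yx0] := eqVneq y x0.
    by rewrite hx0 hne // gx0; case: (g x); do 7 (case=> [//|]).
  rewrite !hne //; case: (g x) (g y) => i ilt [j jlt].
  by do 7 (case: i ilt => [|i] ilt; [by do 7 (case: j jlt => [|j] jlt; [by vm_compute|])|]).
have m1 : (exists w, darc e c w (q q1)) /\ exists w, darc e c (q q1) w.
  split; first by exists x1; apply: arcP; rewrite ?hom ?gx1 ?gq /cycle_rel ?hx1 ?hq ?E1.
  by exists x0; apply: arcP; rewrite ?hom ?gx0 ?gq /cycle_rel ?hx0 ?hq ?E1.
have m6 : (exists w, darc e c w (q q6)) /\ exists w, darc e c (q q6) w.
  split; first by exists x1; apply: arcP; rewrite ?hom ?gx1 ?gq /cycle_rel ?hx1 ?hq ?E6.
  by exists x0; apply: arcP; rewrite ?hom ?gx0 ?gq /cycle_rel ?hx0 ?hq ?E6.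
have m2 : (exists w, darc e c w (q q2)) /\ exists w, darc e c (q q2) w.
  by split; [exists (q q1) | exists (q q3)]; apply: arcP; rewrite ?hom ?gq /cycle_rel ?hq ?E1 ?E2 ?E3.
have m5 : (exists w, darc e c w (q q5)) /\ exists w, darc e c (q q5) w.
  by split; [exists (q q4) | exists (q q6)]; apply: arcP; rewrite ?hom ?gq /cycle_rel ?hq ?E4 ?E5 ?E6.
suff near v : [|| e v (q q1), e v (q q2), e v (q q5) | e v (q q6)].
  by move=> v; case/or4P: (near v) => vu; [case: m1 | case: m2 | case: m5 | case: m6];
    [exists (q q1) | exists (q q2) | exists (q q5) | exists (q q6)];
    split.
rewrite !hom !gq /cycle_rel E1 E2 E5 E6.
by case: (g v); do 7 (case=> [//|]).
Qed.

(** * Moves between colorings *)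

Section Walk.
Variables (T : finType) (e : rel T).
Hypotheses (symE : symmetric e) (irrE : irreflexive e) (conE : connected_graph e).

Lemma connected_ind (P : T -> Prop) x :
  P x -> (forall u v, P u -> e u v -> P v) -> forall v, P v.
Proof.
move=> Px Pe v; have /connectP[p pp ->] := conE x v.
elim: p x Px pp => [//|y p IH] x Px /= /andP[xy yp].
by apply: IH yp; exact: Pe xy.
Qed.

Lemma star_2colorable r :
  (forall u v, u != r -> v != r -> ~~ e u v) -> k_colorable e 2.
Proof.
move=> star; exists (fun v => if v == r then ord0 else ord_max) => u v uv.
have [ur|ur] := eqVneq u r; have [vr|vr] := eqVneq v r => //.
  by rewrite ur vr irrE in uv.
by have := star u v ur vr; rewrite uv.
Qed.

(* Adding 1 to the color of every vertex from which [r] cannot be reached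
   reverses exactly the arcs entering that set, so a coloring with as many
   vertices reaching [r] as possible has all of them reaching [r]. *)
Lemma coloring_reaching r : k_colorable e 3 ->
  exists2 c : T -> 'I_3, proper_coloring e c & forall v, connect (darc e c) v r.
Proof.
case=> c0 pc0; pose P (c : {ffun T -> 'I_3}) := [forall x, forall y, e x y ==> (c x != c y)].
have PP (c : {ffun T -> 'I_3}) : reflect (proper_coloring e c) (P c).
  apply: (iffP forallP) => [H x y|H x]; first by have /forallP/(_ y)/implyP := H x.
  by apply/forallP => y; apply/implyP; exact: H.
have P0 : P [ffun v => c0 v] by apply/PP => x y xy; rewrite !ffunE; exact: pc0.
pose reach (c : {ffun T -> 'I_3}) := [set v | connect (darc e c) v r].
case: (arg_maxnP (fun c => #|reach c|) P0) => c /PP pc cmax.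
exists c => //; apply: NNPP => nreach.
have [u [v [uV vV uv]]] : exists u v, [/\ u \in reach c, v \notin reach c & e u v].
  apply: NNPP => N; apply: nreach => w; apply/negPn/negP => nw.
  suff : w \in reach c by rewrite inE (negbTE nw).
  apply: (@connected_ind (fun w => w \in reach c) r); first by rewrite inE connect0.
  move=> u v uV uv; apply/negPn/negP => vV; apply: N.
  by exists u, v.
pose c' : {ffun T -> 'I_3} := [ffun v => if v \in reach c then c v else sc (c v)].
have step x y : e x y -> x \notin reach c -> y \in reach c -> c x = sc (c y).
  move=> xy xV yV; case: (sc_total (pc _ _ xy)) => // E.
  case/negP: xV; rewrite inE; move: yV; rewrite inE; apply: connect_trans.
  by apply: connect1; rewrite /darc xy E eqxx.
have pc' : proper_coloring e c'.
  move=> x y xy; have yx : e y x by rewrite symE.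
  rewrite !ffunE; case: ifPn => xV; case: ifPn => yV.
  - exact: pc.
  - by rewrite (step y x yx yV xV) eq_sym sc2_neq.
  - by rewrite (step x y xy xV yV) sc2_neq.
  - by rewrite (inj_eq scI); exact: pc.
have sub : reach c \subset reach c'.
  apply/subsetP => x; rewrite inE => /connectP[p].
  elim: p x => [|y p IH] x /=; first by move=> _ <-; rewrite inE connect0.
  case/andP=> xy yp E; have yV : y \in reach c by rewrite inE; apply/connectP; exists p.
  have xV : x \in reach c by rewrite inE; apply/connectP; exists (y :: p) => //=; rewrite xy.
  have := IH y yp E; rewrite !inE; apply: connect_trans; apply: connect1.
  by case/andP: xy => xy cxy; rewrite /darc xy !ffunE xV yV.
have vV' : v \in reach c'.
  have := subsetP sub u uV; rewrite !inE; apply: connect_trans; apply: connect1.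
  have vu : e v u by rewrite symE.
  by rewrite /darc vu !ffunE uV (negbTE vV) (step v u vu vV uV) sc3 eqxx.
have lt : #|reach c| < #|reach c'|.
  by apply: proper_card; apply/properP; split=> //; exists v.
by have := leq_trans lt (cmax c' (introT (PP _) pc')); rewrite ltnn.
Qed.

Definition source (d : T -> 'I_3) v := forall u, e v u -> d u = sc (d v).
Definition sink (d : T -> 'I_3) v := forall u, e v u -> d v = sc (d u).

Hypothesis bad : ~ exists c, good_coloring e c.
Hypothesis not2 : ~ k_colorable e 2.

(** Applying [sc] twice subtracts 1 modulo 3. *)
Definition lower (S : pred T) (d : T -> 'I_3) v := if S v then sc (sc (d v)) else d v.

Definition sinks_at (d : T -> 'I_3) r := proper_coloring e d /\ forall v, sink d v <-> e r v.

Definition movable d y := forall u, e y u -> source d u.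

Lemma proper_arc c u v : proper_coloring e c -> e u v -> darc e c u v \/ darc e c v u.
Proof.
move=> pc uv; have vu : e v u by rewrite symE.
by rewrite /darc uv vu; case: (sc_total (pc _ _ uv)) => ->; rewrite eqxx; [left|right].
Qed.

Lemma not_sink c v : proper_coloring e c -> ~ sink c v -> exists w, darc e c v w.
Proof.
move=> pc ns; apply: NNPP => N; apply: ns => u vu.
case: (proper_arc pc vu) => [|/andP[_ /eqP //]].
by move=> a; case: N; exists u.
Qed.

Lemma not_source c v : proper_coloring e c -> ~ source c v -> exists w, darc e c w v.
Proof.
move=> pc ns; apply: NNPP => N; apply: ns => u vu.
case: (proper_arc pc vu) => [/andP[_ /eqP //]|].
by move=> a; case: N; exists u.
Qed.

Lemma proper_lower d (S : pred T) : proper_coloring e d ->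
  (forall u v, e u v -> S u -> ~~ S v -> d v = sc (d u)) ->
  proper_coloring e (lower S d).
Proof.
move=> pd src u v uv; have vu : e v u by rewrite symE.
rewrite /lower; case: ifPn => Su; case: ifPn => Sv.
- by rewrite !(inj_eq scI); exact: pd.
- by rewrite (src u v uv Su Sv) sc_neq.
- by rewrite (src v u vu Sv Su) eq_sym sc_neq.
- exact: pd.
Qed.

(* Otherwise lowering [r], which makes it the only sink, gives a good coloring. *)
Lemma ex_movable d r : sinks_at d r -> exists2 y, e r y & movable d y.
Proof.
case=> pd sk; apply: NNPP => N; apply: bad.
pose c := lower (pred1 r) d.
have src u : e r u -> d u = sc (d r) by move=> ru; apply: (sk u).2; rewrite // symE.
have pc : proper_coloring e c.
  by apply: proper_lower => // u v uv /= /eqP ur _; rewrite ur in uv *; exact: src.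
have cr : c r = sc (sc (d r)) by rewrite /c /lower /= eqxx.
have cE v : v != r -> c v = d v by rewrite /c /lower /= => /negbTE ->.
have nbr_neq u : e r u -> u != r by apply: contraTneq => ->; rewrite irrE.
have arcE u v : u != r -> v != r -> darc e d u v -> darc e c u v.
  by move=> ur vr; rewrite /darc !cE.
have arc_r u : e r u -> darc e c u r.
  by move=> ru; rewrite /darc symE ru cr cE ?nbr_neq // (src u ru) eqxx.
exists c; split=> // v.
have [->|vr] := eqVneq v r.
  (* A neighbour [u] of [r] with a further neighbour [w] would give the directed path [w], [u], [r];
     without one, connectedness leaves only a star. *)
  apply: NNPP => N'; apply: not2; apply: (@star_2colorable r).
  have closed u : u = r \/ e r u.
    apply: (@connected_ind (fun u => u = r \/ e r u) r); first by left.
    move=> {}u w [->|ru] uw; first by right.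
    left; apply/eqP; apply/negPn/negP => wr; apply: N'; exists u; split => //.
      exists w; apply: arcE => //; first exact: nbr_neq.
      by rewrite /darc symE uw; rewrite ((sk u).2 ru w uw) eqxx.
    by exists r; exact: arc_r.
  move=> u w ur wr; apply/negP => uw; apply: N'.
  have ru : e r u by case: (closed u) => // E; rewrite E eqxx in ur.
  exists u; split => //; last by exists r; exact: arc_r.
  exists w; apply: arcE => //.
  by rewrite /darc symE uw; rewrite ((sk u).2 ru w uw) eqxx.
(* A sink [v] in N(r) is not movable, so some neighbour [u] of it is no source: an in-arc of [u] is
   followed by the arc to [v]. *)
case rv : (e r v).
  have [u vu ns] : exists2 u, e v u & ~ source d u.
    apply: NNPP => N'; apply: N; exists v => // u vu; apply: NNPP => ns.
    by apply: N'; exists u.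
  have [w wu] := not_source pd ns.
  have ur : u != r by apply: contraPneq ns => -> N'; apply: N' => x; exact: src.
  have wr : w != r.
    apply: contraTneq wu => ->; apply/negP => /andP[ru _].
    have uv : e u v by rewrite symE.
    have := sc2_neq (d v); rewrite -((sk u).2 ru v uv) -((sk v).2 rv u vu) eqxx.
    by [].
  exists u; split => //.
    by exists w; exact: arcE.
  exists v; apply: arcE => //.
  by rewrite /darc symE vu ((sk v).2 rv u vu) eqxx.
have out u : u != r -> ~~ e r u -> exists2 w, w != r & darc e d u w.
  move=> ur nru; have [|w uw] := not_sink (v := u) pd; first by move/(sk u); rewrite (negbTE nru).
  by exists w => //; apply: contraNneq nru => <-; case/andP: uw => uw _; rewrite symE.
have [w wr vw] := out v vr (negbT rv).
exists w; split; first by case/andP: vw.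
  by exists v; exact: arcE.
have [rw|nrw] := boolP (e r w); first by exists r; exact: arc_r.
by have [x xr wx] := out w wr nrw; exists x; exact: arcE.
Qed.

(** The lowered sources become sinks. An old sink is adjacent to [r], which lies in N(y), and now
    has an arc into [r]. No other sink arises, since the reversed arcs all enter N(y). *)
Lemma sinks_at_lower d r y : sinks_at d r -> e r y -> movable d y ->
  sinks_at (lower (e y) d) y.
Proof.
case=> pd sk ry mv; have yr : e y r by rewrite symE.
have indep u v : e y u -> e u v -> ~~ e y v.
  move=> yu uv; apply/negP => yv; have vu : e v u by rewrite symE.
  have := mv u yu v uv; rewrite (mv v yv u vu) => E.
  by have := sc2_neq (d v); rewrite -E eqxx.
split; first by apply: proper_lower => // u v uv yu _; exact: mv.
move=> v; split=> [sv|yv u vu]; last first.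
  by rewrite /lower yv (negbTE (indep _ _ yv vu)) (mv v yv u vu).
apply/negPn/negP => nyv.
have lv : lower (e y) d v = d v by rewrite /lower (negbTE nyv).
have /(sk v) rv : sink d v.
  move=> u vu; have := sv u vu; rewrite lv /lower; case: ifPn => // yu.
  have uv : e u v by rewrite symE.
  by rewrite sc3 (mv u yu v uv) => E; have := sc_neq (d u); rewrite E eqxx.
have vr : e v r by rewrite symE.
have := sv r vr; rewrite lv /lower yr sc3 ((sk v).2 rv r vr).
by move=> E; have := sc_neq (d r); rewrite E eqxx.
Qed.

(** Start from a coloring where every vertex reaches [r]. Without a good coloring [r] must be a
    sink, and some neighbour [y] of [r] sees only sources besides [r]; lowering these leaves exactly
    N(y) as sinks. *)
Lemma ex_sinks_at : k_colorable e 3 -> inhabited T ->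
  exists d, exists r, sinks_at d r.
Proof.
move=> k3 [r]; have [c pc reach] := coloring_reaching r k3.
have out v : v != r -> exists w, darc e c v w.
  move=> vr; have /connectP[[|w p] /=] := reach v; first by move=> _ E; rewrite E eqxx in vr.
  by case/andP=> vw _ _; exists w.
have no_arcs u w : darc e c u w -> darc e c w u -> False.
  by case/andP=> _ /eqP E /andP[_ /eqP E']; have := sc2_neq (c u); rewrite -E -E' eqxx.
have rsink : sink c r.
  apply: NNPP => ns; apply: bad; exists c; split=> // v.
  have [w0 rw0] := not_sink pc ns.
  have out' u : exists w, darc e c u w.
    by have [->|ur] := eqVneq u r; [exists w0 | exact: out].
  have [u vu] := out' v; exists u.
  by split; [case/andP: vu | exists v | exact: (out' u)].
have arc_r u : e r u -> darc e c u r by move=> ru; rewrite /darc symE ru (rsink u ru) eqxx.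
have [y [ry yout ysrc]] : exists y, [/\ e r y, forall w, darc e c y w -> w = r &
    forall u, e y u -> u != r -> source c u].
  apply: NNPP => N; apply: bad; exists c; split=> // v.
  have [->|vr] := eqVneq v r.
    (* Otherwise no neighbour of [r] has an in-arc, so every other vertex is adjacent to [r] and the
       graph is a star. *)
    apply: NNPP => N'; apply: not2; apply: (@star_2colorable r).
    have no_in u w : e r u -> ~ darc e c w u.
      move=> ru wu; apply: N'; exists u; split => //; first by exists w.
      by exists r; exact: arc_r.
    have closed u : u != r -> e r u.
      have /connectP[p] := reach u; elim: p u => [|w p IH] u /=.
        by move=> _ <-; rewrite eqxx.
      case/andP=> uw wp E ur; have [wr|wr] := eqVneq w r.
        by case/andP: uw => uw _; rewrite -wr symE.
      by case: (no_in w u) => //; exact: IH.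
    move=> u w ur wr; apply/negP => uw.
    by case: (proper_arc pc uw); apply: no_in; exact: closed.
  have [[u vu ur]|N'] := classic (exists2 u, darc e c v u & u != r).
    by exists u; split; [case/andP: vu | exists v | exact: out].
  have vout u : darc e c v u -> u = r.
    by move=> vu; apply/eqP; apply/negPn/negP => ur; apply: N'; exists u.
  have rv : e r v.
    by have [u vu] := out v vr; rewrite symE -(vout u vu); case/andP: vu.
  have [u [vu ur ns]] : exists u, [/\ e v u, u != r & ~ source c u].
    apply: NNPP => N''; apply: N; exists v; split=> // u vu ur; apply: NNPP => ns.
    by apply: N''; exists u.
  exists u; split => //; first exact: not_source.
  exists v; case: (proper_arc pc vu) => // /vout E.
  by rewrite E eqxx in ur.
have yr : e y r by rewrite symE.
have indep u v : e y u -> u != r -> e u v -> e y v -> v = r.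
  move=> yu ur uv yv; apply/eqP; apply/negPn/negP => vr.
  have vu : e v u by rewrite symE.
  have := ysrc u yu ur v uv; rewrite (ysrc v yv vr u vu) => E.
  by have := sc2_neq (c v); rewrite -E eqxx.
have tri u : e y u -> u != r -> ~~ e u r.
  move=> yu ur; apply/negP => /(ysrc u yu ur) E.
  have := ysrc u yu ur y; rewrite symE yu => /(_ isT); rewrite -E => E'.
  by have := pc _ _ yr; rewrite E' eqxx.
exists (lower (fun u => e y u && (u != r)) c), y; split.
  by apply: proper_lower => // u v uv /andP[yu ur] _; exact: (ysrc u).
move=> v; split=> [sv|yv u vu].
  apply/negPn/negP => nyv; have vr : v != r by apply: contraNneq nyv => ->.
  have [w vw] := out v vr; have evw : e v w by case/andP: vw.
  have := sv w evw; rewrite /lower (negbTE nyv) /=; case: ifPn => [/andP[yw wr] _|_ E].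
    apply: (no_arcs v w vw); rewrite /darc symE evw; apply/eqP; apply: (ysrc w) => //.
    by rewrite symE.
  by case/andP: vw => _ /eqP E'; have := sc2_neq (c v); rewrite -E' -E eqxx.
have [E|vr] := eqVneq v r.
  rewrite E in vu; rewrite /lower E eqxx andbF; case: ifPn => [/andP[yu ur]|_]; last exact: rsink.
  by have := tri u yu ur; rewrite symE vu.
rewrite /lower yv vr /=; case: ifPn => [/andP[yu ur]|_].
  by have := indep v u yv vr vu yu => E; rewrite E eqxx in ur.
by rewrite (ysrc v yv vr u vu).
Qed.

End Walk.

(** * Periodicity of iterates *)

Lemma iter_sc k x : iter k sc x = sc x -> k %% 3 = 1.
Proof.
rewrite {1}(divn_eq k 3) addnC iterD.
have -> : iter (k %/ 3 * 3) sc x = x.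
  by elim: (k %/ 3) => [//|m IH]; rewrite mulSn iterD IH /= sc3.
have : k %% 3 < 3 by rewrite ltn_mod.
case: (k %% 3) => [|[|[|]]] //= _.
  by move=> E; have := sc_neq x; rewrite -E eqxx.
by move/scI => E; have := sc_neq x; rewrite E eqxx.
Qed.

(** Two iterates of [s0] coincide by pigeonhole; reading the cycle between them modulo its length
    extends the orbit to negative times. *)
Lemma periodic_orbit (S : finType) (f : S -> S) (P : S -> Prop) s0 :
  P s0 -> (forall s, P s -> P (f s)) ->
  exists (o : Z -> S) (N : Z), [/\ (0 < N)%Z, forall j, o (j + 1)%Z = f (o j),
    forall j, o (j + N)%Z = o j & forall j, P (o j)].
Proof.
move=> P0 Pf; pose h (i : 'I_(#|S|.+1)) := iter i f s0.
have : ~~ injectiveb h.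
  apply/negP => /injectiveP /leq_card.
  by rewrite card_ord ltnn.
case/injectivePn => p [q pq E].
wlog lt_pq : p q pq E / p < q.
  move=> W; have [|pq'] := ltnP p q; first exact: W.
  by apply: (W q p) => //; [rewrite eq_sym | rewrite ltn_neqAle pq' eq_sym pq].
pose N := q - p; have N0 : 0 < N by rewrite subn_gt0.
have Ez : (0 < Z.of_nat N)%Z by move/ltP: N0; lia.
exists (fun j => iter (p + Z.to_nat (j mod Z.of_nat N)) f s0), (Z.of_nat N); split => //.
- move=> j; have B := Z.mod_pos_bound j (Z.of_nat N) Ez.
  have [Ej|Ej] : (((j + 1) mod Z.of_nat N = j mod Z.of_nat N + 1) \/
    ((j + 1) mod Z.of_nat N = 0 /\ j mod Z.of_nat N = Z.of_nat N - 1))%Z.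
  + rewrite Z.add_mod; last lia.
    have [E1|N1] : (Z.of_nat N = 1 \/ 1 < Z.of_nat N)%Z by lia.
      by right; rewrite E1 !Z.mod_1_r.
    rewrite (Z.mod_small 1); last lia.
    have [lt|ge] := Z.lt_ge_cases (j mod Z.of_nat N + 1) (Z.of_nat N).
      by left; rewrite Z.mod_small //; lia.
    have -> : (j mod Z.of_nat N = Z.of_nat N - 1)%Z by lia.
    right; split => //; have -> : (Z.of_nat N - 1 + 1 = Z.of_nat N)%Z by lia.
    by apply: Z.mod_same; lia.
  + rewrite Ej; have -> : Z.to_nat (j mod Z.of_nat N + 1) = (Z.to_nat (j mod Z.of_nat N)).+1 by lia.
    by rewrite addnS.
  + case: Ej => -> ->; rewrite addn0 -[RHS]iterS -addnS.
    have -> : (Z.to_nat (Z.of_nat N - 1)).+1 = N by lia.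
    by rewrite subnKC 1?ltnW.
- by move=> j; rewrite -{1}[Z.of_nat N]Z.mul_1_l Z.mod_add; last lia.
- by move=> j; elim: (p + _) => [//|k]; exact: Pf.
Qed.

Local Open Scope Z_scope.

(** * Frames *)

Definition twins (T : finType) (e : rel T) u v := e u =1 e v.

Definition twinb (T : finType) (e : rel T) u v := [forall w, e u w == e v w].

Lemma twinP (T : finType) (e : rel T) u v : reflect (twins e u v) (twinb e u v).
Proof. by apply: (iffP forallP) => tuv w; apply/eqP; apply: tuv. Qed.

(* [A(v)] is the set of the [j] with [e v (r j)], as in the header. *)
Record frame (T : finType) (e : rel T) (r : Z -> T) : Prop := Frame {
  fr_adj : forall j, e (r j) (r (j + 1));
  fr_lo : forall v t, exists2 a, a <= t & e v (r a);
  fr_hi : forall v t, exists2 a, t <= a & e v (r a);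
  fr_disj : forall u v a, e u v -> e u (r a) -> ~ e v (r a);
  fr_alt : forall u v a a', e u v -> e u (r a) -> e u (r a') -> a < a' ->
    exists2 b, a < b < a' & e v (r b);
  fr_mod : forall u v a b, e u v -> e u (r a) -> e v (r b) -> a < b ->
    (forall i, a < i < b -> ~ e u (r i) /\ ~ e v (r i)) -> (b - a) mod 3 = 1;
  fr_twin : forall v a, e v (r a) -> e v (r (a + 2)) -> twins e v (r (a + 1));
  fr_dist : forall j, ~ twins e (r j) (r (j + 2)) }.

(** Lets the later constructions be made at time 0 only. *)
Lemma frame_shift (T : finType) (e : rel T) r k :
  frame e r -> frame e (fun j => r (j + k)).
Proof.
case=> adj lo hi disj alt md tw ds; split.
- by move=> j; have := adj (j + k); have -> : j + k + 1 = j + 1 + k by lia.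
- move=> v t; have [a at_ va] := lo v (t + k); exists (a - k); first lia.
  by have -> : a - k + k = a by lia.
- move=> v t; have [a at_ va] := hi v (t + k); exists (a - k); first lia.
  by have -> : a - k + k = a by lia.
- by move=> u v a; exact: disj.
- move=> u v a a' uv ua ua' aa'.
  have [|b bb vb] := alt u v _ _ uv ua ua'; first lia.
  exists (b - k); first lia.
  by have -> : b - k + k = b by lia.
- move=> u v a b uv ua vb ab nb.
  have -> : b - a = (b + k) - (a + k) by lia.
  apply: (md u v) => //; first lia.
  move=> i ii; have := nb (i - k).
  have -> : i - k + k = i by lia.
  by apply; lia.
- move=> v a va va2; have -> : a + 1 + k = a + k + 1 by lia.
  by apply: tw => //; move: va2; have -> : a + 2 + k = a + k + 2 by lia.
- move=> j; have := ds (j + k); by have -> : j + k + 2 = j + 2 + k by lia.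
Qed.

(** In [fr_mod], reversal exchanges [u] and [v] and keeps the difference. *)
Lemma frame_rev (T : finType) (e : rel T) r :
  symmetric e -> frame e r -> frame e (fun j => r (- j)).
Proof.
move=> symE; case=> adj lo hi disj alt md tw ds; split.
- move=> j; have := adj (- (j + 1)); rewrite symE.
  by have -> : - (j + 1) + 1 = - j by lia.
- move=> v t; have [a at_ va] := hi v (- t); exists (- a); first lia.
  by rewrite Z.opp_involutive.
- move=> v t; have [a at_ va] := lo v (- t); exists (- a); first lia.
  by rewrite Z.opp_involutive.
- by move=> u v a; exact: disj.
- move=> u v a a' uv ua ua' aa'.
  have [|b bb vb] := alt u v _ _ uv ua' ua; first lia.
  exists (- b); first lia.
  by rewrite Z.opp_involutive.
- move=> u v a b uv ua vb ab nb.
  have -> : b - a = (- a) - (- b) by lia.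
  rewrite symE in uv.
  apply: (md v u) => //; first lia.
  move=> i ii; have := nb (- i); rewrite Z.opp_involutive.
  by case; first lia.
- move=> v a va va2.
  have -> : - (a + 1) = - (a + 2) + 1 by lia.
  by apply: tw => //; have -> : - (a + 2) + 2 = - a by lia.
- move=> j tj; apply: (ds (- (j + 2))) => w.
  by rewrite -tj; have -> : - (j + 2) + 2 = - j by lia.
Qed.

(** * Gaps in the sets A(v) and orientation by last elements *)

Section FrameTheory.
Variables (T : finType) (e : rel T) (r : Z -> T).
Hypotheses (symE : symmetric e) (irrE : irreflexive e) (fr : frame e r).

Lemma frame_adjp j : e (r j) (r (j - 1)).
Proof. by rewrite symE; have := fr_adj fr (j - 1); have -> : j - 1 + 1 = j by lia. Qed.

Lemma gap1 v a : e v (r a) -> ~ e v (r (a + 1)).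
Proof.
move=> va va1; have [|b] := fr_alt fr va va va1; first lia.
by lia.
Qed.

Lemma next_even v a : e v (r a) -> ~ e v (r (a + 2)) -> ~ e (r a) (r (a + 3)).
Proof.
move=> va na2 ra3; apply: (fr_dist fr (j := a)) => w.
have := fr_twin fr (v := r a) (a := a + 1) (fr_adj fr a).
have -> : a + 1 + 2 = a + 3 by lia.
have -> : a + 1 + 1 = a + 2 by lia.
by move=> /(_ ra3).
Qed.

(** For differences 3 and 4, compare A(v) with A(r_a), which contains a + 1: [fr_mod] from a + 1 to
    a' would make 2 or 3 congruent to 1. *)
Lemma gap v a a' : e v (r a) -> e v (r a') -> a < a' ->
  a' = a + 2 /\ twins e v (r (a + 1)) \/ a + 5 <= a'.
Proof.
move=> va va' aa'; have [?|lt5] := Z.le_gt_cases (a + 5) a'; first by right.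
left; have n1 : ~ e v (r (a + 1)) by exact: gap1.
have ra1 := fr_adj fr a.
have ran1 : ~ e (r a) (r (a + 2)).
  have -> : a + 2 = a + 1 + 1 by lia.
  exact: gap1.
have [E|[E|[E|E]]] : a' = a + 1 \/ a' = a + 2 \/ a' = a + 3 \/ a' = a + 4 by lia.
- by case: n1; rewrite -E.
- by split => //; apply: (fr_twin fr) => //; rewrite -E.
- have n2 : ~ e v (r (a + 2)).
    move/gap1; have -> : a + 2 + 1 = a + 3 by lia.
    by rewrite -E.
  have rav : e (r a) v by rewrite symE.
  suff H : 2 mod 3 = 1 by [].
  have := fr_mod fr rav ra1 va'; rewrite E.
  have -> : a + 3 - (a + 1) = 2 by lia.
  apply; first lia.
  move=> i ii; have -> : i = a + 2 by lia.
  by [].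
- have n3 : ~ e v (r (a + 3)).
    move/gap1; have -> : a + 3 + 1 = a + 4 by lia.
    by rewrite -E.
  (* Otherwise [v] is a twin of both [r (a + 1)] and [r (a + 3)], against [fr_dist]. *)
  have n2 : ~ e v (r (a + 2)).
    move=> v2; apply: (fr_dist fr (j := a + 1)) => w.
    rewrite -(fr_twin fr va v2).
    have -> : a + 1 + 2 = (a + 2) + 1 by lia.
    apply: (fr_twin fr v2).
    by have -> : a + 2 + 2 = a' by lia.
  have rav : e (r a) v by rewrite symE.
  suff H : 3 mod 3 = 1 by [].
  have := fr_mod fr rav ra1 va'; rewrite E.
  have -> : a + 4 - (a + 1) = 3 by lia.
  apply; first lia.
  move=> i ii; have [->|->] : i = a + 2 \/ i = a + 3 by lia.
    by [].
  by split => //; exact: (next_even va).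
Qed.

(** By [gap], other elements of A(r_j) are at least 5 away from j - 1 and j + 1; a distance of 2
    would make [r j] a twin of [r (j + 2)] or [r (j - 2)]. *)
Lemma gap_root j i : j - 6 < i < j + 6 -> e (r j) (r i) -> i = j - 1 \/ i = j + 1.
Proof.
move=> ij ri.
have [ji|ij'] : j + 1 < i \/ i <= j + 1 by lia.
  have [[E tw]|?] := gap (fr_adj fr j) ri ji; last lia.
  case: (fr_dist fr (j := j)) => w; rewrite tw.
  by have -> : j + 1 + 1 = j + 2 by lia.
have [ji|ij''] : i < j - 1 \/ j - 1 <= i by lia.
  have [[E tw]|?] := gap ri (frame_adjp j) ji; last lia.
  case: (fr_dist fr (j := i + 1)) => w; rewrite -tw.
  by have -> : i + 1 + 2 = j by lia.
have [E|?] : i = j \/ i <> j by lia.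
  by rewrite E irrE in ri.
lia.
Qed.

Lemma next_root v t : exists a, [/\ e v (r a), t < a & forall i, t < i < a -> ~ e v (r i)].
Proof.
have [a ta va] := fr_hi fr v (t + 1).
have [m E] : exists m, a - t = Z.of_nat m by exists (Z.to_nat (a - t)); lia.
elim/ltn_ind: m a ta va E => m IH a ta va E.
have [[i [ai vi]]|N] := classic (exists i, t < i < a /\ e v (r i)).
  apply: (IH (Z.to_nat (i - t)) _ i) => //; try lia.
  by apply/ltP; lia.
by exists a; split => //; [lia | move=> i ai vi; apply: N; exists i].
Qed.

Lemma last_root v t : exists a, [/\ e v (r a), a <= t & forall i, a < i <= t -> ~ e v (r i)].
Proof.
have [a ta va] := fr_lo fr v t.
have [m E] : exists m, t - a = Z.of_nat m by exists (Z.to_nat (t - a)); lia.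
elim/ltn_ind: m a ta va E => m IH a ta va E.
have [[i [ai vi]]|N] := classic (exists i, a < i <= t /\ e v (r i)).
  apply: (IH (Z.to_nat (t - i)) _ i) => //; try lia.
  by apply/ltP; lia.
by exists a; split => // i ai vi; apply: N; exists i.
Qed.

Lemma last_next v : exists ln : Z * Z, [/\ e v (r ln.1), e v (r ln.2), ln.1 <= 0 < ln.2 &
  forall i, ln.1 < i < ln.2 -> ~ e v (r i)].
Proof.
have [l [vl l0 nl]] := last_root v 0; have [n [vn n0 nn]] := next_root v 0.
exists (l, n); split=> //= i li; have [?|?] : i <= 0 \/ 0 < i by lia.
  by apply: nl; lia.
by apply: nn; lia.
Qed.

(* [l v] and [n v] are the last element of [A(v)] before time 0 and the first one after. *)
Variables l n : T -> Z.
Hypotheses (el : forall v, e v (r (l v))) (en : forall v, e v (r (n v))).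
Hypotheses (ln0 : forall v, l v <= 0 < n v).
Hypothesis nln : forall v i, l v < i < n v -> ~ e v (r i).

Lemma l_max v i : e v (r i) -> i <= 0 -> i <= l v.
Proof.
move=> vi i0; have [//|li] := Z.le_gt_cases i (l v).
by case: (@nln v i) => //; have := ln0 v; lia.
Qed.

Lemma n_min v i : e v (r i) -> 0 < i -> n v <= i.
Proof.
move=> vi i0; have [//|li] := Z.le_gt_cases (n v) i.
by case: (@nln v i) => //; have := ln0 v; lia.
Qed.

Lemma n_eq v i : e v (r i) -> 0 < i -> (forall k, 0 < k < i -> ~ e v (r k)) -> n v = i.
Proof.
move=> vi i0 N; have nvi := n_min vi i0.
have [E|?] : n v = i \/ n v < i by lia.
  by [].
by case: (N (n v)) => //; have := ln0 v; lia.
Qed.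

Lemma l_eq v i : e v (r i) -> i <= 0 -> (forall k, i < k <= 0 -> ~ e v (r k)) -> l v = i.
Proof.
move=> vi i0 N; have lvi := l_max vi i0.
have [E|?] : l v = i \/ i < l v by lia.
  by [].
by case: (N (l v)) => //; have := ln0 v; lia.
Qed.

Lemma twins_ln u v : twins e u v -> l u = l v /\ n u = n v.
Proof.
move=> uv; split.
- apply: l_eq; [by rewrite uv | by have := ln0 v; lia |].
  by move=> k k0; rewrite uv; apply: nln; have := ln0 v; lia.
- apply: n_eq; [by rewrite uv | by have := ln0 v; lia |].
  by move=> k k0; rewrite uv; apply: nln; have := ln0 v; lia.
Qed.

Lemma l_neq u v : e u v -> l u <> l v.
Proof. by move=> uv luv; apply: (fr_disj fr uv (el u)); rewrite luv. Qed.

(** Alternation puts an element of A(u) between l v and n v; as l u < l v, it is positive and bounds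
    n u. *)
Lemma l_lt_n_lt u v : e u v -> l u < l v -> n u < n v.
Proof.
move=> uv luv; have vu : e v u by rewrite symE.
have [|b lbn ub] := fr_alt fr vu (el v) (en v); first by have := ln0 v; lia.
have [?|?] := Z.le_gt_cases b 0; first by have := l_max ub; lia.
by have := n_min ub; lia.
Qed.

Lemma n_lt_l_lt u v : e u v -> n u < n v -> l u < l v.
Proof.
move=> uv nuv; have [//|luv] := Z.lt_ge_cases (l u) (l v).
have vu : e v u by rewrite symE.
have := l_neq uv; have := @l_lt_n_lt v u vu; lia.
Qed.

(** Alternation leaves no element of either set strictly between l u and l v. So [l] modulo 3 is a
    proper coloring, with arcs towards larger [l]. *)
Lemma l_mod u v : e u v -> l u < l v -> (l v - l u) mod 3 = 1.
Proof.
move=> uv luv; apply: (fr_mod fr uv) => // i ii.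
have lv := ln0 v; have lu := ln0 u.
have nu : ~ e u (r i) by apply: nln; lia.
split=> // vi; have vu : e v u by rewrite symE.
have [|b ib ub] := fr_alt fr vu vi (el v); first lia.
by apply: (@nln u b) => //; lia.
Qed.

(* The orientation given by the coloring [l - 1_D] (mod 3), for a set [D] that
   is closed under predecessors in the orientation given by [l]. *)
Definition arcD (D : pred T) u v :=
  e u v /\ (if D u then D v /\ l u < l v else D v \/ l u < l v).

Definition initial (D : pred T) := forall u v, e u v -> l u < l v -> D v -> D u.

Lemma flip_good D : initial D ->
  (forall v, exists u, [/\ e v u, exists w, arcD D w u & exists w, arcD D u w]) ->
  exists c, good_coloring e c.
Proof.
move=> iD gD; pose K v := l v - (if D v then 1 else 0).
have arcK u v : arcD D u v -> darc e (fun x => col (K x)) u v.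
  case=> uv; rewrite /darc uv /= /K => duv; apply/eqP; apply: col_sc.
  case Du: (D u) duv; case Dv: (D v).
  - case=> _ luv; have := l_mod uv luv.
    by have -> : l v - 1 - (l u - 1) = l v - l u by lia.
  - by case.
  (* As [D] is initial, l v < l u here; subtracting 1 at [v] turns the difference -1 into -2, which
     is 1 modulo 3. *)
  - move=> _; have vu : e v u by rewrite symE.
    have luv : l v < l u.
      have ne := l_neq uv; have [//|luv] := Z.lt_ge_cases (l v) (l u).
      have : D u by apply: (iD u v uv) => //; lia.
      by rewrite Du.
    by have := l_mod vu luv; Z.to_euclidean_division_equations; lia.
  - case=> // luv; have := l_mod uv luv.
    by have -> : l v - 0 - (l u - 0) = l v - l u by lia.
exists (fun x => col (K x)); split.
- have pr u v : e u v -> l u < l v -> col (K u) != col (K v).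
    move=> uv luv; have [|] : arcD D v u \/ arcD D u v.
    + have vu : e v u by rewrite symE.
      rewrite /arcD uv vu; case Dv: (D v).
        by rewrite (iD u v uv luv Dv); right.
      by case: (D u); [left; split=> //; left | right; split=> //; right].
    + by case/arcK/andP=> _ /eqP ->; exact: sc_neq.
    + by case/arcK/andP=> _ /eqP ->; rewrite eq_sym; exact: sc_neq.
  move=> u v uv; have := l_neq uv; have [luv|luv] := Z.lt_ge_cases (l u) (l v).
    by move=> _; exact: pr.
  by move=> ne; rewrite eq_sym; apply: pr; [rewrite symE | lia].
- move=> v; have [u [vu [w wu] [w' uw']]] := gD v; exists u; split => //.
    by exists w; exact: arcK.
  by exists w'; exact: arcK.
Qed.

(** The arc goes to [r (l v)]: if l v = 0, this vertex is lowered; if l v < 0, it sees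
    [r (l v + 1)], so its own [l] is larger. *)
Lemma out_arcD D v : initial D -> D (r 0) -> ~~ D v -> exists2 u, arcD D v u &
  (u = r 0 \/ ~~ D u) /\ (l v = 0 -> u = r 0).
Proof.
move=> iD D0 Dv; have ev := el v; have lv := ln0 v.
have [E|lneg] : l v = 0 \/ l v < 0 by lia.
  exists (r 0); last by split; [left|].
  by split; [rewrite -E | rewrite (negbTE Dv); left].
have luv : l v < l (r (l v)).
  have : l v + 1 <= l (r (l v)).
    apply: l_max; last lia.
    exact: (fr_adj fr).
  lia.
exists (r (l v)); last by split; [right; apply: contra Dv; exact: iD | lia].
by split=> //; rewrite (negbTE Dv); right.
Qed.

Lemma n_root j : 2 <= j <= 6 -> n (r j) = j - 1.
Proof.
move=> jj; apply: n_eq; [exact: frame_adjp | lia |].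
by move=> k kj /gap_root; lia.
Qed.

Lemma l_root j : 2 <= j <= 6 -> l (r j) <= j - 6.
Proof.
move=> jj; have [//|ll] := Z.le_gt_cases (l (r j)) (j - 6).
by have := gap_root (j := j) _ (el (r j)); have := ln0 (r j); lia.
Qed.

Lemma l_rootN j : -5 <= j <= -1 -> l (r j) = j + 1.
Proof.
move=> jj; apply: l_eq; [exact: (fr_adj fr) | lia |].
by move=> k kj /gap_root; lia.
Qed.

Lemma n_rootN j : -5 <= j <= -1 -> j + 6 <= n (r j).
Proof.
move=> jj; have [//|nn] := Z.le_gt_cases (j + 6) (n (r j)).
by have := gap_root (j := j) _ (en (r j)); have := ln0 (r j); lia.
Qed.

Lemma ln_root0 : l (r 0) = -1 /\ n (r 0) = 1.
Proof.
split; first by apply: (l_eq (frame_adjp 0)) => // k kk /gap_root; lia.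
by apply: (n_eq (fr_adj fr 0)) => // k kk /gap_root; lia.
Qed.

Lemma ln_root1 : l (r 1) = 0 /\ n (r 1) = 2.
Proof.
split; first by apply: (l_eq (frame_adjp 1)) => // k kk /gap_root; lia.
by apply: (n_eq (fr_adj fr 1)) => // k kk /gap_root; lia.
Qed.

Lemma adj_lt u v : e u v -> n u < n v -> forall D : pred T, D u = D v -> arcD D u v.
Proof.
move=> uv nuv D Duv; split=> //; have luv := n_lt_l_lt uv nuv.
by case E: (D u); [split=> //; rewrite -Duv | right].
Qed.

Lemma arc_in (D : pred T) u v : e u v -> ~~ D u -> D v -> arcD D u v.
Proof. by move=> uv /negbTE Du Dv; split=> //; rewrite Du; left. Qed.

(** * Good colorings in a frame *)

(* The lowered vertices r_0, r_2, r_3, r_4 make r_0 and r_4 the only sinks. *)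
Lemma good_short :
  (forall v, e v (r 0) -> e v (r 5) -> exists z w,
    [/\ e v z, e z (r 4), e z w, e w (r 3) & ~ twins e w (r 4)]) ->
  exists c, good_coloring e c.
Proof.
move=> short; have [l0 n0] := ln_root0; have [l1 n1] := ln_root1.
have n2 := @n_root 2; have n3 := @n_root 3; have n4 := @n_root 4; have n5 := @n_root 5.
have l2 := @l_root 2; have l3 := @l_root 3; have l4 := @l_root 4; have l5 := @l_root 5.
have lN1 := @l_rootN (-1); have lN2 := @l_rootN (-2).
have nN1 := @n_rootN (-1); have nN2 := @n_rootN (-2).
pose D : pred T := fun v =>
  [|| twinb e v (r 0), twinb e v (r 2), twinb e v (r 3) | twinb e v (r 4)].
have Dln v : D v -> l v < 0 /\ n v <= 3.
  by case/or4P => /twinP /twins_ln [-> ->]; lia.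
have Dr i : i = 0 \/ i = 2 \/ i = 3 \/ i = 4 -> D (r i).
  by case=> [|[|[]]] ->; apply/or4P;
    [constructor 1 | constructor 2 | constructor 3 | constructor 4]; apply/twinP.
have Dn v : l v = 0 \/ 3 < n v -> ~~ D v by move=> ?; apply/negP => /Dln; lia.
have twr v i j : twins e v (r i) -> j = i + 1 \/ j = i - 1 -> e v (r j).
  by move=> -> [] ->; [exact: (fr_adj fr) | exact: frame_adjp].
have D4 v : e v (r 3) -> n v = 3 -> D v -> twins e v (r 4).
  move=> v3 nv /or4P[] /twinP // /[dup] tw /twins_ln; try lia.
(* Predecessors have smaller [n]. Those of r_0 and r_2 would have n < 1; one of r_3 has n = 1, sees
   r_1 and r_3, and is a twin of r_2; one of r_4 is likewise a twin of r_3. *)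
have iD : initial D.
  move=> u v uv luv Dv; have nuv := l_lt_n_lt uv luv; have := ln0 u => lnu.
  have vu : e v u by rewrite symE.
  case/or4P: Dv => /twinP tw; have [lv nv] := twins_ln tw.
  - lia.
  - lia.
  - have nu : n u = 1 by lia.
    apply/or4P; constructor 2; apply/twinP.
    apply: (fr_twin fr (a := 1)); first by rewrite -nu.
    by rewrite symE -tw.
  - have u4 : e u (r 4) by rewrite symE -tw.
    case: (gap (en u) u4 ltac:(lia)).
      case=> nu twu; apply/or4P; constructor 3; apply/twinP.
      by have <- : n u + 1 = 3 by lia.
    lia.
have N1 : ~~ D (r 1) by apply: Dn; lia.
have a12 : arcD D (r 1) (r 2) by apply: arc_in => //; [exact: (fr_adj fr) | apply: Dr; lia].
have a23 : arcD D (r 2) (r 3).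
  by apply: adj_lt; [exact: (fr_adj fr) | lia | rewrite !Dr //; lia].
have a34 : arcD D (r 3) (r 4).
  by apply: adj_lt; [exact: (fr_adj fr) | lia | rewrite !Dr //; lia].
have out v : ~ twins e v (r 0) -> ~ twins e v (r 4) -> exists w, arcD D v w.
  move=> v0 v4; case Dv : (D v); last first.
    by have [|w vw _] := out_arcD iD (v := v) _ (negbT Dv); [apply: Dr; lia | exists w].
  case/or4P: (Dv) => /twinP // tw.
    exists (r 3); apply: adj_lt; [by rewrite tw; exact: (fr_adj fr) | |].
      by have := twins_ln tw; lia.
    by rewrite Dv Dr //; lia.
  exists (r 4); apply: adj_lt; [by rewrite tw; exact: (fr_adj fr) | |].
    by have := twins_ln tw; lia.
  by rewrite Dv Dr //; lia.
apply: (flip_good iD) => v.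
have [tw0|v0] := twinP e v (r 0).
  exists (r (-1)); split; first by apply: (twr _ _ _ tw0); lia.
    exists (r (-2)); apply: adj_lt; [exact: (fr_adj fr) | | rewrite !(negbTE (Dn _ _)) //; lia].
    apply: l_lt_n_lt; [exact: (fr_adj fr) | lia].
  exists (r 0); apply: arc_in; [exact: (fr_adj fr) | apply: Dn; lia | apply: Dr; lia].
have [tw1|v1] := twinP e v (r 1).
  by exists (r 2); split; [apply: (twr _ _ _ tw1); lia | exists (r 1) | exists (r 3)].
have [tw4|v4] := twinP e v (r 4).
  by exists (r 3); split; [apply: (twr _ _ _ tw4); lia | exists (r 2) | exists (r 4)].
have [tw3|v3] := twinP e v (r 3).
  by exists (r 2); split; [apply: (twr _ _ _ tw3); lia | exists (r 1) | exists (r 3)].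
have lnv := ln0 v.
(* Here n v = 4 and l v < 0, so [v] has an out-neighbour outside [D], which is no sink. *)
case e4 : (e v (r 4)).
  have nv4 : n v = 4.
    apply: n_eq => // k k0 vk; case: (gap vk e4 ltac:(lia)).
      by case=> E; have -> : k + 1 = 3 by lia.
    lia.
  have Dv : ~~ D v by apply: Dn; lia.
  have [|u vu [Du lvu]] := out_arcD iD (v := v) _ Dv; first by apply: Dr; lia.
  have [evu _] := vu.
  have lv : l v < 0.
    case: (gap (el v) e4 ltac:(lia)).
      lia.
    lia.
  have uv : e u v by rewrite symE.
  case: Du => [E|Du].
    by rewrite E in evu; have := l_max evu; lia.
  exists u; split => //; first by exists v.
  apply: out => tw.
    by move: Du; rewrite /D; case/or4P; constructor 1; apply/twinP.
  by move: Du; rewrite /D; case/or4P; constructor 4; apply/twinP.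
case e0 : (e v (r 0)); last first.
  have [u vu] := out v v0 v4; have [evu _] := vu.
  exists u; split => //; first by exists v.
  by apply: out => tw; move: evu; rewrite symE tw symE ?e0 ?e4.
have lv : l v = 0 by apply: l_eq => //; lia.
have Dv : ~~ D v by apply: Dn; left.
have nv5 : 5 <= n v.
  case: (gap e0 (en v) ltac:(lia)).
    by case.
  lia.
have vn := en v.
have nvr : e (r (n v)) v by rewrite symE.
(* The path [w], [z], [v] has n = 3, 4, 5; in the other case r_(n v - 1), r_(n v), [v] has n = n v -
   2, n v - 1, n v. None of these is lowered, so arcs follow [n]. *)
have [E5|n6] : n v = 5 \/ 6 <= n v by lia.
  have [|z [w [vz z4 zw w3 w4]]] := short _ e0; first by rewrite -E5.
  have nz : n z = 4.
    apply: n_eq => // k k0 zk; case: (gap zk z4 ltac:(lia)).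
      case=> E twz; case: (@nln v 3); first lia.
      have -> : 3 = k + 1 by lia.
      by rewrite symE -twz symE.
    lia.
  have nw : n w = 3.
    apply: n_eq => // k k0 wk; case: (gap wk w3 ltac:(lia)).
      case=> E tww; case: (@nln z 2); first by have := ln0 z; lia.
      have -> : 2 = k + 1 by lia.
      by rewrite symE -tww symE.
    lia.
  have Dz : ~~ D z by apply: Dn; lia.
  have Dw : ~~ D w by apply/negP => /(D4 _ w3 nw).
  exists z; split => //.
    by exists w; apply: adj_lt; [rewrite symE | lia | rewrite (negbTE Dz) (negbTE Dw)].
  by exists v; apply: adj_lt; [rewrite symE | lia | rewrite (negbTE Dz) (negbTE Dv)].
have nu : n (r (n v)) = n v - 1.
  apply: n_eq; [exact: frame_adjp | lia |].
  move=> k kk uk; have [b bb vb] := fr_alt fr nvr uk (frame_adjp (n v)) ltac:(lia).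
  by case: (@nln v b) => //; lia.
have wu : e (r (n v - 1)) (r (n v)) by rewrite symE; exact: frame_adjp.
have nw : n (r (n v - 1)) = n v - 2.
  have w2 : e (r (n v - 1)) (r (n v - 2)).
    have -> : n v - 2 = n v - 1 - 1 by lia.
    exact: frame_adjp.
  apply: n_eq => //; first lia.
  move=> k kk uk; have [b bb vb] := fr_alt fr wu uk w2 ltac:(lia).
  by case: (@nln (r (n v)) b) => //; have := ln0 (r (n v)); lia.
have Du : ~~ D (r (n v)) by apply: Dn; lia.
have Dw : ~~ D (r (n v - 1)) by apply: Dn; lia.
exists (r (n v)); split => //.
  by exists (r (n v - 1)); apply: adj_lt => //; [lia | rewrite (negbTE Du) (negbTE Dw)].
by exists v; apply: adj_lt => //; [lia | rewrite (negbTE Du) (negbTE Dv)].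
Qed.

(* Lowering all ancestors of [x] makes [x] the only sink. *)
Lemma good_forward x : e x (r 0) -> e x (r 5) ->
  (forall z, e x z -> e z (r 1) -> ~ e z (r 6)) ->
  exists c, good_coloring e c.
Proof.
move=> x0 x5 nz; have [l0 n0] := ln_root0; have [l1 n1] := ln_root1.
have n3 := @n_root 3; have n4 := @n_root 4; have n5 := @n_root 5.
pose up := [rel u v | e u v && (l u <? l v)].
pose D : pred T := fun v => connect up v x.
(* By [gap], an element between 0 and 5 could only be 2, which is too close to 5. *)
have lnx : l x = 0 /\ n x = 5.
  have lnx := ln0 x; split.
    by have := l_max x0; lia.
  apply: (n_eq x5) => // k k0 xk; case: (gap x0 xk ltac:(lia)); last by lia.
  by case=> E _; case: (gap xk x5 ltac:(lia)); lia.
have upn u v : up u v -> n u < n v.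
  by case/andP=> uv /Z.ltb_lt; exact: l_lt_n_lt.
have Dstep v : D v -> v = x \/ exists2 w, up v w & D w.
  case/connectP=> -[|w p] /= => [_ ->|/andP[vw wp] E]; first by left.
  by right; exists w => //; apply/connectP; exists p.
have Dx : D x by exact: connect0.
have Dn v : D v -> v = x \/ n v < 5.
  case/connectP=> p; elim: p v => [|w p IH] v /= => [_ ->|/andP[vw wp] E]; first by left.
  by right; have := upn _ _ vw; case: (IH w wp E) => [->|]; lia.
have iD : initial D.
  move=> u v uv luv Dv; apply: connect_trans Dv; apply: connect1.
  by rewrite /= uv; apply/Z.ltb_lt.
have inD u v : e u v -> n u < n v -> D v -> D u.
  by move=> uv nuv; apply: iD => //; exact: n_lt_l_lt.
have D0 : D (r 0) by apply: (inD _ x); [rewrite symE | lia | ].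
have D5 : D (r 5) by apply: (inD _ x); [rewrite symE | lia | ].
have D4 : D (r 4) by apply: (inD _ (r 5)) => //; [exact: (fr_adj fr) | lia].
have D3 : D (r 3) by apply: (inD _ (r 4)) => //; [exact: (fr_adj fr) | lia].
have D1 : ~~ D (r 1).
  apply/negP => /Dstep [E|[w /andP[_ /Z.ltb_lt]]]; last by have := ln0 w; lia.
  by case: lnx; rewrite -E; lia.
have out v : v <> x -> exists w, arcD D v w.
  move=> vx; case Dv : (D v); last first.
    by have [|w vw _] := out_arcD iD (v := v) _ (negbT Dv) => //; exists w.
  case: (Dstep v Dv) => // -[w /andP[vw /Z.ltb_lt lvw] Dw]; exists w.
  by split=> //; rewrite Dv.
apply: (flip_good iD) => v.
have [->|/eqP vx] := eqVneq v x.
  exists (r 0); split => //.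
    by exists (r 1); apply: arc_in => //; rewrite symE; exact: (fr_adj fr).
  by exists x; apply: adj_lt; [rewrite symE | lia | rewrite Dx D0].
case xv : (e x v); last first.
  have [u vu] := out v vx; have [evu _] := vu.
  exists u; split => //; first by exists v.
  by apply: out => ux; move: xv; rewrite symE -ux evu.
have lnv := ln0 v.
(* Alternation with [x] puts an element of A(v) between 0 and 5, and [fr_mod] then leaves n v = 1 or
   n v = 4. *)
have nvx : n v < 5 by have [b bb vb] := fr_alt fr xv x0 x5 ltac:(lia); have := n_min vb; lia.
have Dv : D v by apply: (inD _ x); [rewrite symE | lia |].
have nm : n v mod 3 = 1.
  have <- : n v - 0 = n v by lia.
  apply: (fr_mod fr xv x0 (en v)); first lia.
  move=> i ii; split; apply: nln; last lia.
  by lia.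
have [E4|E1] : n v = 4 \/ n v = 1.
  by have := Z.mod_bound_pos; move: nm; Z.to_euclidean_division_equations; lia.
  have v4 := en v; rewrite E4 in v4.
  exists (r 4); split => //.
    by exists (r 3); apply: adj_lt; [exact: (fr_adj fr) | lia | rewrite D3 D4].
  by exists v; apply: adj_lt; [rewrite symE | lia | rewrite D4].
have v1 := en v; rewrite E1 in v1.
(* The next element is not 3, since [v] would be a twin of r_2, which [x] does not see, and not 6 by
   hypothesis. With a at least 7, both r_(a - 1) and r_a lie outside [D], and r_(a - 1), r_a, [v] is
   a directed path. *)
have [a [va a1 na]] := next_root v 1.
have a7 : 7 <= a.
  case: (gap v1 va a1).
    case=> _ tw; case: (@nln x 2); first lia.
    have -> : 2 = 1 + 1 by lia.
    by rewrite symE in xv; rewrite symE -tw.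
  move=> a6; have [E|?] : a = 6 \/ 7 <= a by lia.
    by case: (nz v xv v1); rewrite -E.
  by [].
have uv : e (r a) v by rewrite symE.
have nu : n (r a) = a - 1.
  apply: n_eq; [exact: frame_adjp | lia |].
  move=> k kk uk; have [b bb vb] := fr_alt fr uv uk (frame_adjp a) ltac:(lia).
  have [?|[?|?]] : b < 1 \/ b = 1 \/ 1 < b by lia.
  - by have := n_min vb; lia.
  - have k0 : k < 1 by lia.
    by lia.
  - by case: (na b) => //; lia.
have wu : e (r (a - 1)) (r a) by rewrite symE; exact: frame_adjp.
have nw : n (r (a - 1)) = a - 2.
  have w2 : e (r (a - 1)) (r (a - 2)).
    have -> : a - 2 = a - 1 - 1 by lia.
    exact: frame_adjp.
  apply: n_eq => //; first lia.
  move=> k kk uk; have [b bb vb] := fr_alt fr wu uk w2 ltac:(lia).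
  by case: (@nln (r a) b) => //; have := ln0 (r a); lia.
have Du : ~~ D (r a).
  by apply/negP => /Dn [E|]; [case: lnx; rewrite -E | ]; lia.
have Dw : ~~ D (r (a - 1)).
  apply/negP => /Dn [E|]; last lia.
  rewrite E in wu.
  have [b bb vb] := fr_alt fr wu x0 x5 ltac:(lia).
  by case: (@nln (r a) b) => //; have := ln0 (r a); lia.
exists (r a); split => //.
  by exists (r (a - 1)); apply: adj_lt => //; [lia | rewrite (negbTE Du) (negbTE Dw)].
by exists v; apply: arc_in.
Qed.

(** r_(-3) and r_4 agree in [l] and [n]. If they are not twins, the first can be lowered without the
    second, which gives both the path r_1, r_2, r_3, r_(-3) and the arc from r_4 to r_5. *)
Lemma good_period6 : (forall j, e (r j) (r (j + 6))) -> ~ twins e (r (-3)) (r 4) ->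
  exists c, good_coloring e c.
Proof.
move=> r6 ntw; have [l0 n0] := ln_root0; have [l1 n1] := ln_root1.
have r6p j k : k = j - 6 -> e (r j) (r k).
  by move=> ->; rewrite symE; have := r6 (j - 6); have -> : j - 6 + 6 = j by lia.
have r6s j k : k = j + 6 -> e (r j) (r k) by move=> ->; exact: r6.
have l_r j : 2 <= j <= 5 -> l (r j) = j - 6.
  by move=> jj; have := l_max (r6p j _ erefl); have := l_root (j := j); lia.
have n_r j : -5 <= j <= -1 -> n (r j) = j + 6.
  by move=> jj; have := n_min (r6 j); have := n_rootN (j := j); lia.
(* A(r_a) contains a + 1 and a + 6; an element of A(v) between them must be a + 2 or a + 5 by
   [gap]. *)
have step v a : e v (r a) -> twins e v (r (a + 1)) \/ e v (r (a + 5)).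
  move=> va; have av : e (r a) v by rewrite symE.
  have [b bb vb] := fr_alt fr av (fr_adj fr a) (r6 a) ltac:(lia).
  case: (gap va vb ltac:(lia)) => [[_ tw]|?]; [by left | right].
  by have -> : a + 5 = b by lia.
pose D : pred T := fun v => [&& n v <=? 3, ~~ twinb e v (r 1) & ~~ twinb e v (r 4)].
have nr := n_root.
have DP v : n v <= 3 -> l v < 0 -> ~ twins e v (r 4) -> D v.
  move=> nv lv v4; apply/and3P; split; first by apply/Z.leb_le.
    by apply/twinP => /twins_ln; lia.
  by apply/twinP.
have DN v : 3 < n v \/ l v = 0 \/ twins e v (r 4) -> ~~ D v.
  move=> H; apply/negP => /and3P[/Z.leb_le n3 /twinP v1 /twinP v4].
  case: H => [|[lv|//]]; first lia.
  have vl := el v; rewrite lv in vl; case: (step _ _ vl) => // v5.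
  have lnv := ln0 v; case: (gap vl (en v) ltac:(lia)); last by lia.
  by case=> _.
have iD : initial D.
  move=> u v uv luv Dv; have nuv := l_lt_n_lt uv luv.
  have nv3 : n v <= 3.
    have [//|n3] := Z.le_gt_cases (n v) 3.
    by move: Dv; rewrite (negbTE (DN v _)) //; left; lia.
  apply: DP; [lia | have := ln0 v; lia | move/twins_ln; have := nr 4; lia].
have adj j k : k = j + 1 -> e (r j) (r k) by move=> ->; exact: (fr_adj fr).
have root j k : twins e (r j) (r k) -> j + 2 = k -> False.
  by move=> tw E; apply: (fr_dist fr (j := j)); rewrite E.
have D0 : D (r 0) by apply: DP; [lia | lia | move/twins_ln; have := nr 4; lia].
have D2 : D (r 2) by apply: DP; [rewrite nr; lia | rewrite l_r; lia | move/root; lia].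
have D3 : D (r 3) by apply: DP; [rewrite nr; lia | rewrite l_r; lia | move/twins_ln; rewrite !nr; lia].
have DN3 : D (r (-3)) by apply: DP; [rewrite n_r; lia | rewrite l_rootN; lia |].
have DN4 : D (r (-4)).
  by apply: DP; [rewrite n_r; lia | rewrite l_rootN; lia | move/twins_ln; rewrite n_r ?nr; lia].
have D1 : ~~ D (r 1) by apply: DN; lia.
have D4 : ~~ D (r 4) by apply: DN; right; right.
have D5 : ~~ D (r 5) by apply: DN; left; rewrite nr; lia.
have DN1 : ~~ D (r (-1)) by apply: DN; left; rewrite n_r; lia.
have DN2 : ~~ D (r (-2)) by apply: DN; left; rewrite n_r; lia.
have a12 : arcD D (r 1) (r 2) by apply: arc_in => //; apply: adj.
have a23 : arcD D (r 2) (r 3) by apply: adj_lt; [apply: adj | rewrite !nr; lia | rewrite D2 D3].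
have a43 : arcD D (r (-4)) (r (-3)).
  by apply: adj_lt; [apply: adj | rewrite !n_r; lia | rewrite DN3 DN4].
have a33 : arcD D (r 3) (r (-3)).
  by apply: adj_lt; [apply: r6p | rewrite nr ?n_r; lia | rewrite DN3 D3].
have a21 : arcD D (r (-2)) (r (-1)).
  by apply: adj_lt; [apply: adj | rewrite !n_r; lia | rewrite (negbTE DN2) (negbTE DN1)].
have a10 : arcD D (r (-1)) (r 0) by apply: arc_in => //; apply: adj.
have a45 : arcD D (r 4) (r 5).
  by apply: adj_lt; [apply: adj | rewrite !nr; lia | rewrite (negbTE D4) (negbTE D5)].
apply: (flip_good iD) => v; have lnv := ln0 v.
have [tw|v0] := twinP e v (r 0).
  exists (r (-1)); split; [|by exists (r (-2))|by exists (r 0)].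
  by rewrite tw symE; apply: adj.
have [tw|v1] := twinP e v (r 1).
  exists (r 2); split; [|by exists (r 1)|by exists (r 3)].
  by rewrite tw; apply: adj.
(* [gap] and [step] leave the differences 2 and 5, and 2 would make [v] a twin of r_0 or r_1. *)
have nv : n v = l v + 5.
  have nlv : n v <= l v + 5 \/ twins e v (r (l v + 1)).
    case: (step _ _ (el v)) => [|v5]; first by right.
    left; have [?|?] := Z.le_gt_cases (n v) (l v + 5); first by [].
    by case: (@nln v (l v + 5)) => //; lia.
  have lv2 : n v = l v + 2 -> False.
    move=> E; have v2 := en v; rewrite E in v2.
    have tw := fr_twin fr (el v) v2.
    have [E'|E'] : l v + 1 = 0 \/ l v + 1 = 1 by lia.
      by apply: v0; rewrite -E'.
    by apply: v1; rewrite -E'.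
  case: (gap (el v) (en v) ltac:(lia)) => [[]|?]; first by move=> /lv2.
  case: nlv => [|tw]; first lia.
  case: lv2; have [_ nr'] := twins_ln tw.
  have vl2 : e v (r (l v + 2)) by rewrite tw; apply: adj; lia.
  case: (gap (el v) vl2 ltac:(lia)) => [[]|]; last lia.
  move=> _ _; have [?|?] := Z.le_gt_cases (l v + 2) 0.
    by have := l_max vl2; lia.
  by have := n_min vl2; lia.
have vln := el v; have vn := en v.
have Dv : n v < 3 -> D v.
  by move=> n3; apply: DP; [lia | lia | move/twins_ln; have := nr 4; lia].
have [E|[E|[E|[E|E]]]] : n v = 1 \/ n v = 2 \/ n v = 3 \/ n v = 4 \/ n v = 5 by lia.
- have E' : l v = -4 by lia.
  rewrite E' in vln; exists (r (-4)); split => //; last by exists (r (-3)).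
  by exists v; apply: adj_lt => //; [rewrite n_r; lia | rewrite DN4 Dv //; lia].
- by rewrite E in vn; exists (r 2); split => //; [exists (r 1) | exists (r 3)].
- by rewrite E in vn; exists (r 3); split => //; [exists (r 2) | exists (r (-3))].
- have E' : l v = -1 by lia.
  by rewrite E' in vln; exists (r (-1)); split => //; [exists (r (-2)) | exists (r 0)].
- rewrite E in vn; exists (r 5); split => //; first by exists (r 4).
  have Nv : ~~ D v by apply: DN; lia.
  exists v; apply: adj_lt; [by rewrite symE | rewrite nr; lia | by rewrite (negbTE D5) (negbTE Nv)].
Qed.

End FrameTheory.

(** * Without a good coloring: period 7 and the cycle C_7 *)

Section NoGoodColoring.
Variables (T : finType) (e : rel T) (r : Z -> T).
Hypotheses (symE : symmetric e) (irrE : irreflexive e) (fr : frame e r).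
Hypothesis bad : ~ exists c, good_coloring e c.

Lemma ex_last_next (r' : Z -> T) : frame e r' -> exists l n : T -> Z,
  [/\ forall v, e v (r' (l v)), forall v, e v (r' (n v)), forall v, l v <= 0 < n v &
  forall v i, l v < i < n v -> ~ e v (r' i)].
Proof.
move=> fr'; have [f Pf] := fin_all_exists (last_next fr').
by exists (fun v => (f v).1), (fun v => (f v).2); split=> v; case: (Pf v).
Qed.

(** Stated for every frame so that it also serves the reversed one. *)
Lemma forward_nbr (r' : Z -> T) : frame e r' -> forall x j,
  e x (r' j) -> e x (r' (j + 5)) ->
  exists z, [/\ e x z, e z (r' (j + 1)) & e z (r' (j + 6))].
Proof.
move=> fr' x j x0 x5; apply: NNPP => N; apply: bad.
have frj := frame_shift j fr'.
have [l [n [el en ln nln]]] := ex_last_next frj.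
apply: (good_forward symE irrE frj el en ln nln (x := x)) => //.
  by rewrite Z.add_comm.
move=> z xz; rewrite ![_ + j]Z.add_comm => z1 z6; apply: N; exists z; split => //.
Qed.

Lemma backward_nbr x j : e x (r j) -> e x (r (j + 5)) ->
  exists z, [/\ e x z, e z (r (j - 1)) & e z (r (j + 4))].
Proof.
move=> x0 x5; have := forward_nbr (frame_rev symE fr) (x := x) (j := - (j + 5)).
rewrite Z.opp_involutive => /(_ x5).
have -> : - (- (j + 5) + 5) = j by lia.
have -> : - (- (j + 5) + 1) = j + 4 by lia.
have -> : - (- (j + 5) + 6) = j - 1 by lia.
by move=> /(_ x0) [z [xz z4 z1]]; exists z.
Qed.

(** Two backward steps from [v] with j + 2 and j + 7 in A(v) reach [w] with j and j + 5 in A(w).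
    Either [w] is a twin of r_(j + 6), which then sees r_j, or [good_short] would apply. *)
Lemma adj6 j : e (r j) (r (j + 6)).
Proof.
have frj := frame_shift (j + 2) fr.
have [l [n [el en ln nln]]] := ex_last_next frj.
apply: NNPP => N; apply: bad; apply: (good_short symE irrE frj el en ln nln) => v v0 v5.
apply: NNPP => N'; apply: N.
have [||z [vz z1 z4]] := backward_nbr (x := v) (j := j + 2) => //.
  by have -> : j + 2 + 5 = 5 + (j + 2) by lia.
have [||w [zw w2 w3]] := backward_nbr (x := z) (j := j + 2 - 1) => //.
  by have -> : j + 2 - 1 + 5 = j + 2 + 4 by lia.
have tw : twins e w (r (j + 6)).
  apply: NNPP => tw; apply: N'; exists z, w; split => //.
  - by have -> : 4 + (j + 2) = j + 2 + 4 by lia.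
  - by have -> : 3 + (j + 2) = j + 2 - 1 + 4 by lia.
  - by have -> : 4 + (j + 2) = j + 6 by lia.
rewrite symE -tw.
by have -> : j = j + 2 - 1 - 1 by lia.
Qed.

Lemma twins7 j : twins e (r j) (r (j + 7)).
Proof.
have frj := frame_shift (j + 3) fr.
have [l [n [el en ln nln]]] := ex_last_next frj.
apply: NNPP => N; apply: bad; apply: (good_period6 symE irrE frj el en ln nln).
  move=> i; have -> : i + 6 + (j + 3) = i + (j + 3) + 6 by lia.
  exact: adj6.
have -> : -3 + (j + 3) = j by lia.
by have -> : 4 + (j + 3) = j + 7 by lia.
Qed.

Lemma root_adj i j : -7 < i - j < 7 -> e (r i) (r j) =
  [|| j =? i + 1, i =? j + 1, j =? i + 6 | i =? j + 6].
Proof.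
move=> ij; apply/idP/idP => [rij|].
  have [E|[E|E]] : j = i + 6 \/ i = j + 6 \/ i - 6 < j < i + 6 by lia.
  - by apply/or4P; constructor 3; apply/Z.eqb_eq.
  - by apply/or4P; constructor 4; apply/Z.eqb_eq.
  - case: (gap_root symE irrE fr E rij) => E'.
      by apply/or4P; constructor 2; apply/Z.eqb_eq; lia.
    by apply/or4P; constructor 1; apply/Z.eqb_eq.
case/or4P => /Z.eqb_eq E.
- by rewrite E; exact: (fr_adj fr).
- by rewrite E symE; exact: (fr_adj fr).
- by rewrite E; exact: adj6.
- by rewrite E symE; exact: adj6.
Qed.

Lemma root_twins_eq i j : twins e (r i) (r j) -> i <= j < i + 7 -> i = j.
Proof.
move=> tw ij; have [//|ij'] : i = j \/ i < j by lia.
have e1 : e (r i) (r (j + 1)) by rewrite tw; exact: (fr_adj fr).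
have e2 : e (r i) (r (j - 1)) by rewrite tw; exact: (frame_adjp symE fr).
have [?|?] : j < i + 5 \/ i + 5 <= j by lia.
  by have := gap_root symE irrE fr (i := j + 1) _ e1; lia.
by have := gap_root symE irrE fr (i := j - 1) _ e2; lia.
Qed.

(** A(v) has period 7. If it contains a, it also contains a + 2, or a + 5 and a + 7; [v] is a twin
    of the root in between, which a multiple of 7 moves into the window at [k]. *)
Lemma ex_root v k : exists i : 'I_7, twins e v (r (k + Z.of_nat i)).
Proof.
have e7 m a : e v (r a) -> e v (r (a + 7 * m)).
  have H (m' : nat) b : e v (r b) = e v (r (b + 7 * Z.of_nat m')).
    elim: m' => [|m' IH]; first by have -> : b + 7 * Z.of_nat 0 = b by lia.
    have -> : b + 7 * Z.of_nat m'.+1 = b + 7 * Z.of_nat m' + 7 by lia.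
    by rewrite IH ![e v _]symE (twins7 _ v).
  move=> va; have [m0|m0] := Z.le_gt_cases 0 m.
    by have := H (Z.to_nat m) a; rewrite Z2Nat.id // => <-.
  rewrite (H (Z.to_nat (- m)) (a + 7 * m)).
  by have -> : a + 7 * m + 7 * Z.of_nat (Z.to_nat (- m)) = a by lia.
have [b vb tb] : exists2 b, e v (r (b - 1)) & twins e v (r b).
  have [a _ va] := fr_lo fr v 0.
  have av : e (r a) v by rewrite symE.
  have [b bb vb] := fr_alt fr av (fr_adj fr a) (adj6 a) ltac:(lia).
  case: (gap symE fr va vb ltac:(lia)) => [[_ tw]|?].
    by exists (a + 1) => //; have -> : a + 1 - 1 = a by lia.
  have v7 : e v (r (b + 2)).
    have -> : b + 2 = a + 7 * 1 by lia.
    exact: e7.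
  exists (b + 1); first by have -> : b + 1 - 1 = b by lia.
  exact: (fr_twin fr).
have i7 : (Z.to_nat ((b - k) mod 7) < 7)%coq_nat by have := Z.mod_pos_bound (b - k) 7; lia.
exists (Ordinal (introT ltP i7)) => /=.
have [m E] : exists m, k + Z.of_nat (Z.to_nat ((b - k) mod 7)) = b - 7 * m.
  by exists ((b - k) / 7); have := Z.mod_pos_bound (b - k) 7; have := Z.div_mod (b - k) 7; lia.
have -> : k + Z.of_nat (Z.to_nat ((b - k) mod 7)) = b - 7 * m - 1 + 1 by lia.
apply: (fr_twin fr).
  have -> : b - 7 * m - 1 = b - 1 + 7 * (- m) by lia.
  exact: e7.
have -> : b - 7 * m - 1 + 2 = b + 1 + 7 * (- m) by lia.
by apply: e7; rewrite tb; exact: (fr_adj fr).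
Qed.

(** The base [k] is free so that any chosen class can be numbered 0. *)
Lemma ex_C7_hom k : exists (g : T -> 'I_7),
  [/\ forall v, twins e v (r (k + Z.of_nat (g v))),
      forall v (i : 'I_7), twins e v (r (k + Z.of_nat i)) -> g v = i &
      forall x y, e x y = cycle_rel 7 (g x) (g y)].
Proof.
have [g tg] := fin_all_exists (ex_root^~ k).
have tsym u v : twins e u v -> twins e v u by move=> uv w; rewrite uv.
have lt7 (i : 'I_7) : Z.of_nat i < 7 by have := ltn_ord i => /ltP; lia.
have gE x (i : 'I_7) : twins e x (r (k + Z.of_nat i)) -> g x = i.
  move=> tw; apply: val_inj => /=.
  have tw' : twins e (r (k + Z.of_nat (g x))) (r (k + Z.of_nat i)).
    by move=> w; rewrite -tg tw.
  have g7 := lt7 (g x); have i7 := lt7 i.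
  have [le|ge] := Z.le_gt_cases (Z.of_nat i) (Z.of_nat (g x)).
    by have := root_twins_eq (tsym _ _ tw'); lia.
  by have := root_twins_eq tw'; lia.
exists g; split => //.
move=> x y; rewrite tg symE tg.
have g7 := lt7 (g x); have i7 := lt7 (g y).
rewrite root_adj; last by lia.
have Ek a b c : (k + a =? k + b + c) = (a =? b + c).
  by case: (Z.eqb_spec (a) (b + c)) => ?; [apply/Z.eqb_eq | apply/Z.eqb_neq]; lia.
rewrite !Ek /cycle_rel; case: (g x) (g y) {g7 i7} => i ilt [j jlt] /=.
by do 7 (case: i ilt => [|i] ilt;
  [by do 7 (case: j jlt => [|j] jlt; [by vm_compute|])|]).
Qed.

Lemma iso_C7 : graph_iso e (cycle_rel 7).
Proof.
have [g [tg gE hom]] := ex_C7_hom 0.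
have gr (i : 'I_7) : g (r (0 + Z.of_nat i)) = i by apply: gE.
have [injg|ninj] := boolP (injectiveb g).
  have ig := injectiveP _ injg.
  exists g; split => //; exists (fun i : 'I_7 => r (0 + Z.of_nat i)) => // v.
  by apply: ig; rewrite gr.
case/injectivePn: ninj => x0 [x1 x01 g01]; case: bad.
have [g' [_ gE' hom']] := ex_C7_hom (Z.of_nat (g x0)).
have g0 v : g v = g x0 -> g' v = ord0.
  move=> gv; apply: gE' => w; rewrite tg gv.
  by have -> : 0 + Z.of_nat (g x0) = Z.of_nat (g x0) + Z.of_nat (@ord0 6) by rewrite /=; lia.
have gx0 := g0 x0 erefl; have gx1 : g' x1 = ord0 by apply: g0.
apply: (C7_blowup_good irrE hom' _ x01 gx0 gx1) => i.
exact: (gE' (r (Z.of_nat (g x0) + Z.of_nat i))).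
Qed.

End NoGoodColoring.

(** * The frame of a periodic walk *)

Section Frame.
Variables (T : finType) (e : rel T).
Hypotheses (symE : symmetric e) (irrE : irreflexive e) (conE : connected_graph e).
Hypothesis bad : ~ exists c, good_coloring e c.
Hypothesis not2 : ~ k_colorable e 2.

Definition movableb (d : T -> 'I_3) y := [forall u, e y u ==> [forall w, e u w ==> (d w == sc (d u))]].

Lemma movableP d y : reflect (movable e d y) (movableb d y).
Proof.
apply: (iffP forallP) => H u.
  by move=> yu w uw; have /implyP/(_ yu)/forallP/(_ w)/implyP/(_ uw)/eqP := H u.
by apply/implyP => yu; apply/forallP => w; apply/implyP => uw; apply/eqP; exact: H.
Qed.

(* Among the possible moves one of minimal degree is taken: this is what makes
   a vertex sharing two consecutive roots a twin of the root in between. *)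
Lemma ex_move (s : {ffun T -> 'I_3} * T) : exists s' : {ffun T -> 'I_3} * T,
  sinks_at e s.1 s.2 -> [/\ e s.2 s'.2, movable e s.1 s'.2,
    s'.1 =1 lower (e s'.2) s.1, sinks_at e s'.1 s'.2 &
    forall v, e s.2 v -> movable e s.1 v -> leq #|e s'.2| #|e v|].
Proof.
have [sk|] := classic (sinks_at e s.1 s.2); last by exists s.
have [y0 ry0 /movableP mv0] := ex_movable symE irrE conE bad not2 sk.
pose P y := e s.2 y && movableb s.1 y.
have P0 : P y0 by rewrite /P ry0.
case: (arg_minnP (fun y => #|e y|) P0) => y /andP[ry /movableP mv] ymin.
exists ([ffun v => lower (e y) s.1 v], y) => _ /=; split => //.
- by move=> v; rewrite ffunE.
- have [pd skl] := sinks_at_lower symE sk ry mv; split=> [u v|v].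
    by rewrite !ffunE; exact: pd.
  rewrite -skl; split=> H u vu; first by have := H u vu; rewrite !ffunE.
  by rewrite !ffunE; exact: H.
- by move=> v rv /movableP mv'; apply: ymin; rewrite /P rv.
Qed.

(** The chosen move is a map on the finite set of pairs of a coloring and a root, so it has a
    periodic orbit. *)
Lemma ex_walk : k_colorable e 3 -> inhabited T ->
  exists (d : Z -> T -> 'I_3) (r : Z -> T) (N : Z),
  [/\ 0 < N /\ (forall j, r (j + N) = r j), forall j, e (r j) (r (j + 1)),
    forall j, sinks_at e (d j) (r j) /\ movable e (d j) (r (j + 1)),
    forall j, d (j + 1) =1 lower (e (r (j + 1))) (d j) &
    forall j v, e (r j) v -> movable e (d j) v -> leq #|e (r (j + 1))| #|e v|].
Proof.
move=> k3 ex; have [d0 [r0 sk0]] := ex_sinks_at symE irrE conE bad not2 k3 ex.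
have [f fP] := fin_all_exists ex_move.
have sk0' : sinks_at e ([ffun v => d0 v], r0).1 ([ffun v => d0 v], r0).2.
  case: sk0 => pd sk /=; split=> [u v|v]; first by rewrite !ffunE; exact: pd.
  rewrite -sk; split=> H u vu; first by have := H u vu; rewrite !ffunE.
  by rewrite !ffunE; exact: H.
have [|o [N [N0 of_ oN oP]]] := periodic_orbit (f := f) (P := fun s => sinks_at e s.1 s.2) sk0'.
  by move=> s /fP[].
exists (fun j => (o j).1 : {ffun T -> 'I_3}), (fun j => (o j).2), N; split.
- by split=> // j; rewrite oN.
- by move=> j; rewrite of_; case: (fP _ (oP j)).
- by move=> j; rewrite of_; split; [exact: oP | case: (fP _ (oP j))].
- by move=> j; rewrite of_; case: (fP _ (oP j)).
- by move=> j; rewrite of_; case: (fP _ (oP j)).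
Qed.

Section WalkFrame.
Variables (d : Z -> T -> 'I_3) (r : Z -> T) (N : Z).
Hypotheses (N0 : 0 < N) (rN : forall j, r (j + N) = r j).
Hypotheses (radj : forall j, e (r j) (r (j + 1))).
Hypotheses (dsk : forall j, sinks_at e (d j) (r j)).
Hypotheses (dmv : forall j, movable e (d j) (r (j + 1))).
Hypotheses (dS : forall j, d (j + 1) =1 lower (e (r (j + 1))) (d j)).
Hypotheses (dmin : forall j v, e (r j) v -> movable e (d j) v -> leq #|e (r (j + 1))| #|e v|).

Lemma walk_sink j u : e u (r j) -> sink e (d j) u.
Proof. by move=> uj; have [_ sk] := dsk j; apply/sk; rewrite symE. Qed.

Lemma walk_source j u : e u (r (j + 1)) -> source e (d j) u.
Proof. by move=> uj; apply: (dmv (j := j)); rewrite symE. Qed.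

Lemma walk_stay j v : ~ e v (r (j + 1)) -> d (j + 1) v = d j v.
Proof. by move=> vj; rewrite dS /lower symE; case: ifP. Qed.

Lemma sc_asym x y : x = sc y -> y = sc x -> False.
Proof. by move=> E E'; have := sc2_neq x; rewrite -E' -E eqxx. Qed.

(** [u] is a sink just after being lowered at [a] and a source just before [a']; its edge to [v]
    must have turned, so [v] was lowered in between. *)
Lemma walk_alt u v a a' : e u v -> e u (r a) -> e u (r a') -> a < a' ->
  exists2 b, a < b < a' & e v (r b).
Proof.
move=> uv ua ua' aa'; apply: NNPP => nb.
have vu : e v u by rewrite symE.
have H (k : nat) : a + Z.of_nat k < a' ->
    d (a + Z.of_nat k) u = sc (d (a + Z.of_nat k) v).
  elim: k => [|k IH] lt; first by rewrite Z.add_0_r; exact: walk_sink.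
  have E := IH ltac:(lia).
  have Ek : a + Z.of_nat k.+1 = a + Z.of_nat k + 1 by lia.
  rewrite Ek !walk_stay //.
    by move=> vk; apply: nb; exists (a + Z.of_nat k + 1) => //; lia.
  by move/walk_source/(_ _ uv)/sc_asym; exact.
have E := H (Z.to_nat (a' - 1 - a)) ltac:(lia).
have Ea : a + Z.of_nat (Z.to_nat (a' - 1 - a)) = a' - 1 by lia.
rewrite Ea in E; have ua1 : e u (r (a' - 1 + 1)) by have -> : a' - 1 + 1 = a' by lia.
exact: sc_asym E (walk_source ua1 uv).
Qed.

Lemma walk_disj u v a : e u v -> e u (r a) -> ~ e v (r a).
Proof.
move=> uv ua va; apply: sc_asym (walk_sink ua uv) _.
by apply: walk_sink va _ _; rewrite symE.
Qed.

Lemma walk_rootS j : d (j + 1) (r (j + 1)) = sc (d j (r j)).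
Proof.
rewrite walk_stay ?irrE //; apply: walk_sink; rewrite symE; exact: radj.
Qed.

(** At time a, [v] and r_a have the same color, one below the sink [u]. At b, [v] is lowered and r_b
    is one below it, so r_b is r_a minus 2, that is plus 1, while the color of the root grows by 1
    at each step. *)
Lemma walk_mod u v a b : e u v -> e u (r a) -> e v (r b) -> a < b ->
  (forall i, a < i < b -> ~ e u (r i) /\ ~ e v (r i)) -> (b - a) mod 3 = 1.
Proof.
move=> uv ua vb ab nb.
have H (k : nat) : a + Z.of_nat k < b -> d (a + Z.of_nat k) v = d a v.
  elim: k => [|k IH] lt; first by rewrite Z.add_0_r.
  have Ek : a + Z.of_nat k.+1 = a + Z.of_nat k + 1 by lia.
  rewrite Ek walk_stay; first by apply: IH; lia.
  by apply: (nb _ _).2; lia.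
have rootE (k : nat) : d (a + Z.of_nat k) (r (a + Z.of_nat k)) = iter k sc (d a (r a)).
  elim: k => [|k IH]; first by rewrite Z.add_0_r.
  have -> : a + Z.of_nat k.+1 = a + Z.of_nat k + 1 by lia.
  by rewrite walk_rootS IH.
have Eb := H (Z.to_nat (b - 1 - a)) ltac:(lia).
have E1 : a + Z.of_nat (Z.to_nat (b - 1 - a)) = b - 1 by lia.
rewrite E1 in Eb.
have dv : d a v = d a (r a).
  apply: scI; rewrite -(walk_sink ua uv); apply: (walk_sink ua); first by [].
have := rootE (Z.to_nat (b - a)).
have -> : a + Z.of_nat (Z.to_nat (b - a)) = b by lia.
have -> : d b (r b) = sc (d a (r a)).
  apply: scI; rewrite -(walk_sink vb vb) -dv -Eb.
  have E2 : b = b - 1 + 1 by lia.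
  by rewrite {1}E2 dS /lower -E2 symE vb.
move/esym/iter_sc => E.
have := divn_eq (Z.to_nat (b - a)) 3; rewrite E.
move: (Z.to_nat (b - a) %/ 3)%nat => q Eq.
have {}Eq : b - a = Z.of_nat q * 3 + 1.
  by rewrite -multE -plusE in Eq; lia.
by rewrite Eq Z.add_comm Z.mod_add.
Qed.

(** Alternation puts a + 1 in A(u) for every neighbour [u] of [v], so N(v) lies in N(r_(a + 1)).
    Thus [v] was a possible move at [a], and minimality of the degree forces equality. *)
Lemma walk_twin v a : e v (r a) -> e v (r (a + 2)) -> twins e v (r (a + 1)).
Proof.
move=> va va2.
have sub u : e v u -> e (r (a + 1)) u.
  move=> vu; have [b bb ub] := walk_alt vu va va2 ltac:(lia).
  have -> : a + 1 = b by lia.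
  by rewrite symE.
have mv : movable e (d a) v by move=> u /sub; exact: dmv.
have av : e (r a) v by rewrite symE.
have /subset_cardP E : #|e v| = #|e (r (a + 1))|.
  by apply/eqP; rewrite eqn_leq dmin // andbT; apply: subset_leq_card; apply/subsetP.
by move=> w; have := E (introT subsetP sub) w.
Qed.

(** Otherwise [walk_twin] makes neighbours of r_j twins of r_(j + 1) and conversely; by
    connectedness there are only two twin classes and the graph is 2-colorable. *)
Lemma walk_dist j : ~ twins e (r j) (r (j + 2)).
Proof.
move=> tw; apply: not2.
have r2 : e (r (j + 1)) (r (j + 2)) by have := radj (j + 1); have -> : j + 1 + 1 = j + 2 by lia.
have N0_ u : e (r j) u -> twins e u (r (j + 1)).
  by move=> ju; apply: walk_twin; rewrite symE // -tw.
have tw3 : twins e (r (j + 3)) (r (j + 1)).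
  apply: N0_; rewrite tw.
  by have := radj (j + 2); have -> : j + 2 + 1 = j + 3 by lia.
have N1 u : e (r (j + 1)) u -> twins e u (r j).
  move=> ju w; rewrite tw; have -> : j + 2 = j + 1 + 1 by lia.
  apply: walk_twin; rewrite symE //.
  have -> : j + 1 + 2 = j + 3 by lia.
  by rewrite tw3.
have two : forall v, twins e v (r j) \/ twins e v (r (j + 1)).
  apply: (connected_ind conE (x := r j)); first by left.
  move=> u v [tu|tu] uv; rewrite tu in uv; [right; exact: N0_ | left; exact: N1].
exists (fun v => if twinb e v (r j) then ord0 else ord_max) => u v uv.
case: twinP => tu; case: twinP => tv //.
  have := radj j; rewrite -tv (N0_ v) ?irrE //.
  by rewrite -tu.
case: (two u) => // tu'; case: tv; apply: N1; rewrite -tu'; exact: uv.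
Qed.

(** Periodicity gives this for [r 0], and alternation passes it on along edges. *)
Lemma walk_recurrent v t : (exists2 a, a <= t & e v (r a)) /\ exists2 a, t <= a & e v (r a).
Proof.
move: t; apply: (connected_ind conE (x := r 0)
  (P := fun v => forall t, (exists2 a, a <= t & e v (r a)) /\ exists2 a, t <= a & e v (r a))).
  have rNk (k : nat) j : r (j + Z.of_nat k * N) = r j.
    elim: k => [|k IH]; first by rewrite Z.add_0_r.
    by rewrite -[RHS]IH -(rN (j + Z.of_nat k * N)); congr r; lia.
  move=> t; split.
    pose k := Z.to_nat (1 - t); exists (1 - Z.of_nat k * N); first by rewrite /k; nia.
    rewrite -(rNk k (1 - Z.of_nat k * N)); have -> : 1 - Z.of_nat k * N + Z.of_nat k * N = 0 + 1 by lia.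
    exact: radj.
  pose k := Z.to_nat t; exists (1 + Z.of_nat k * N); first by rewrite /k; nia.
  by rewrite (rNk k 1); exact: (radj 0).
move=> u w Pu uw t.
have [_ [a ta ua]] := Pu t; have [_ [a' ta' ua']] := Pu (a + 1).
have [[b tb ub] _] := Pu t; have [[b' tb' ub'] _] := Pu (b - 1).
split.
  by have [c cc wc] := walk_alt uw ub' ub ltac:(lia); exists c => //; lia.
by have [c cc wc] := walk_alt uw ua ua' ltac:(lia); exists c => //; lia.
Qed.

Lemma walk_frame : frame e r.
Proof.
split.
- exact: radj.
- by move=> v t; case: (walk_recurrent v t).
- by move=> v t; case: (walk_recurrent v t).
- exact: walk_disj.
- exact: walk_alt.
- exact: walk_mod.
- exact: walk_twin.
- exact: walk_dist.
Qed.

End WalkFrame.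

Lemma ex_frame : k_colorable e 3 -> inhabited T -> exists r, frame e r.
Proof.
move=> k3 ex; have [d [r [N [[N0 rN] radj dskmv dS dmin]]]] := ex_walk k3 ex.
exists r; apply: (walk_frame N0 rN radj _ _ dS dmin) => j; by case: (dskmv j).
Qed.

End Frame.

Local Close Scope Z_scope.

Theorem theorem2 (T : finType) (e : rel T) :
  simple_graph e ->
  connected_graph e ->
  chromatic_number_eq e 3 ->
  ~ graph_iso e (cycle_rel 7) ->
  exists c : T -> 'I_3, proper_coloring e c /\ forall x : T, colorful_path3_from e c x.
Proof.
move=> [symE irrE] conE [k3 not2] not7; apply: NNPP => none.
have bad : ~ exists c, good_coloring e c.
  case=> c gc; apply: none; exists c; split; first by case: gc.
  exact: good_coloring_colorful.
have inh : inhabited T.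
  apply: NNPP => N; apply: not2; exists (fun _ => ord0) => x; by case: N; exists.
have [r fr] := ex_frame symE irrE conE bad not2 k3 inh.
apply: not7; exact: (iso_C7 symE irrE fr bad).
Qed.
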